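(* Let $M \ge 2$ be a natural number and let $$q_M = \min\left(\bigcap_{n=2}^{M} S_{p_n}\right).$$ If $q_M \in [p_M, 2p_M]$, then $q_M$ and $q_M+2$ are a pair of twin primes (that is, both are prime).
   Context: Let $p_n$ denote the $n$-th prime number ($p_1=2$, $p_2=3$, $p_3=5$, …). For each $n \ge 1$ define $$S_{p_n} = \{a \in \mathbb{N} : a \text{ is odd},\ a > p_n,\ \gcd(a, p_n) = \gcd(a+2, p_n) = 1\}.$$ For every $M\ge 2$ the intersection $\bigcap_{n=2}^{M} S_{p_n}$ is a nonempty set of natural numbers, so its minimum exists. *)

(* Defs.v *)
From mathcomp Require Import all_boot.

Set Implicit Arguments.
Unset Strict Implicit.
Unset Printing Implicit Defensive.

Lemma ex_prime_gt m : exists p, (m < p) && prime p.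
Proof. by have [p ltmp pr_p] := prime_above m; exists p; rewrite ltmp. Qed.

Definition next_prime (m : nat) : nat := ex_minn (ex_prime_gt m).

(* Indexing starts at 1: nth_prime 1 = 2, nth_prime 2 = 3, nth_prime 3 = 5;
   nth_prime 0 = 0 is a junk value. *)
Definition nth_prime (n : nat) : nat := iter n next_prime 0.

Lemma next_prime_gt m : m < next_prime m.
Proof. by rewrite /next_prime; case: ex_minnP => p /andP[]. Qed.

Lemma prime_nth_prime n : 0 < n -> prime (nth_prime n).
Proof.
case: n => // n _; rewrite /nth_prime iterS /next_prime.
by case: ex_minnP => p /andP[].
Qed.

Lemma nth_prime_ltS n : nth_prime n < nth_prime n.+1.
Proof. by rewrite /nth_prime iterS next_prime_gt. Qed.

Lemma nth_prime_surj p : prime p -> exists2 n, 0 < n & nth_prime n = p.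
Proof.
move=> pr_p; have: p <= nth_prime p.
  by elim: {pr_p}p => // n IHn; apply: leq_ltn_trans IHn (nth_prime_ltS n).
elim: {2}p => [|n IHn]; first by rewrite leqNgt prime_gt0.
have [le_pn _|lt_np le_pS] := leqP p (nth_prime n); first exact: IHn.
exists n.+1 => //; apply/eqP; rewrite eqn_leq le_pS andbT.
rewrite /nth_prime iterS /next_prime; case: ex_minnP => q _; apply.
by rewrite lt_np.
Qed.

Definition Sset (p : nat) : pred nat :=
  [pred a | [&& odd a, p < a, gcdn a p == 1 & gcdn (a + 2) p == 1]].

Definition capS (M : nat) : pred nat :=
  [pred a | all (fun n => a \in Sset (nth_prime n)) (index_iota 2 M.+1)].

Lemma capSP M a :
  reflect (forall n, 2 <= n <= M -> a \in Sset (nth_prime n)) (a \in capS M).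
Proof.
apply: (iffP allP) => aS n; last by rewrite mem_index_iota ltnS; apply: aS.
by move=> n_in; apply: aS; rewrite mem_index_iota ltnS.
Qed.

Lemma ex_capS M : exists a, a \in capS M.
Proof.
pose P := \prod_(2 <= n < M.+1) nth_prime n.
have P_gt0 : 0 < P.
  rewrite /P big_seq; apply: prodn_cond_gt0 => n; rewrite mem_index_iota.
  by case/andP=> n_gt1 _; rewrite prime_gt0 // prime_nth_prime // ltnW.
exists (2 * P).-1; apply/capSP => n n_in; have /andP[n_gt1 _] := n_in.
set p := nth_prime n.
have p_gt2 : 2 < p.
  have p1_gt1 : 1 < nth_prime 1 by rewrite prime_gt1 // prime_nth_prime.
  rewrite /p; elim: n n_gt1 {n_in p} => // [[|[|n]]] // IHn _.
    exact: leq_ltn_trans p1_gt1 (nth_prime_ltS _).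
  exact: ltn_trans (IHn _) (nth_prime_ltS _).
have dvd_p : p %| 2 * P.
  by rewrite dvdn_mull // /P (big_rem n) ?dvdn_mulr //= mem_index_iota ltnS.
have le_pP : p <= P.
  by apply: dvdn_leq => //; rewrite /P (big_rem n) ?dvdn_mulr //= mem_index_iota ltnS.
have P2_gt0 : 0 < 2 * P by rewrite muln_gt0.
have cop x : p %| x -> 0 < x -> coprime x.-1 p /\ coprime x.+1 p.
  case: x => // x p_x _; split; rewrite coprime_sym.
    exact: coprime_dvdl p_x (coprimeSn x).
  exact: coprime_dvdl p_x (coprimenS x.+1).
have [copl copr] := cop _ dvd_p P2_gt0.
rewrite !inE -!/(coprime _ _) copl addn2 prednK // copr !andbT.
apply/andP; split; first by rewrite -[odd _]negbK -oddS prednK // oddM.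
rewrite -ltnS prednK // mul2n -addnn.
by rewrite (leq_trans _ (leq_add le_pP le_pP)) // -addn2 leq_add2l ltnW.
Qed.

Definition q_min (M : nat) : nat := ex_minn (ex_capS M).

(* Main.v *)
(** An odd number coprime to the odd primes up to [p_M] has all its prime
    factors above [p_M], so it is prime as soon as it is less than
    [(p_M + 1) ^ 2]; both [q_M] and [q_M + 2] are at most [2 p_M + 2]. *)
Require Import Defs.
From mathcomp Require Import all_boot.

Lemma nth_prime_mono : {mono nth_prime : m n / m <= n}.
Proof. by apply: leq_mono; apply: homo_ltn nth_prime_ltS; apply: ltn_trans. Qed.

(** Since 2 occurs at some index [n >= 1], monotonicity gives [nth_prime 1 <= 2]; every prime is at
    least 2. *)
Lemma nth_prime1 : nth_prime 1 = 2.
Proof.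
have [n n_gt0 En] := nth_prime_surj (isT : prime 2).
apply/eqP; rewrite eqn_leq prime_gt1 ?prime_nth_prime // andbT.
by rewrite -[leqRHS]En nth_prime_mono.
Qed.

Lemma prime_coprime_nth_primes M x :
    odd x -> 1 < x -> x < (nth_prime M).+1 ^ 2 ->
    (forall n, 2 <= n <= M -> coprime x (nth_prime n)) ->
  prime x.
Proof.
move=> odd_x x_gt1 x_lt cop_x; have x_gt0 := ltnW x_gt1.
(* It suffices that [x < pdiv x ^ 2]; comparing squares leaves [nth_prime M < pdiv x]. *)
apply: ltn_pdiv2_prime => //; apply: leq_trans x_lt _; rewrite leq_sqr.
have [n n_gt0 En] := nth_prime_surj (pdiv_prime x_gt1).
rewrite -En ltnNge nth_prime_mono; apply/negP=> le_nM.
have dvd_x : nth_prime n %| x by rewrite En pdiv_dvd.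
(* Index 1 lies outside the range of [cop_x]: there the prime is 2, which the oddness of [x]
   excludes. *)
have [n_le1 | n_gt1] := leqP n 1.
  have n1 : n = 1 by apply/eqP; rewrite eqn_leq n_le1.
  by move: dvd_x; rewrite n1 nth_prime1 dvdn2 odd_x.
have := cop_x n; rewrite n_gt1 le_nM coprime_sym prime_coprime ?prime_nth_prime //.
by rewrite dvd_x => /(_ isT).
Qed.

Theorem theorem2 (M : nat) (hM : 2 <= M)
  (hq : nth_prime M <= q_min M <= 2 * nth_prime M) :
  prime (q_min M) /\ prime (q_min M + 2).
Proof.
case/andP: hq => _; rewrite /q_min; case: ex_minnP => q /capSP qS _ le_q.
have M_in : 2 <= M <= M by rewrite hM leqnn.
have /and4P[odd_q lt_pq _ _] := qS M M_in.
have p_gt1 : 1 < nth_prime M by rewrite prime_gt1 // prime_nth_prime // ltnW.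
have q_gt1 : 1 < q := ltn_trans p_gt1 lt_pq.
have lt_q2 : q + 2 < (nth_prime M).+1 ^ 2.
  (* Strictness comes from the second comparison, which amounts to [2 < (nth_prime M).+1]. *)
  apply: (@leq_ltn_trans (2 * (nth_prime M).+1)).
    by rewrite mulnS addnC leq_add2l.
  by rewrite ltn_pmul2r.
split; apply: (@prime_coprime_nth_primes M) => //.
- by apply: leq_ltn_trans lt_q2; apply: leq_addr.
- by move=> n /qS /and4P[].
- by rewrite oddD odd_q.
- by rewrite addn2.
- by move=> n /qS /and4P[].
Qed.
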